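(* For all integers $n\geq k\geq 1$, $$\sum_{\pi\in P_{n,k}}\mathrm{sumelements}(\pi)=S_{n,k}\sum_{a=1}^{k}\frac{a(a-1)}{2}+\sum_{i=1}^{k-1}\left(\frac{(k-i)i(i+1)}{2}\sum_{j=1}^{n-k}S_{n-j,k}\,i^{j-1}\right),$$ where $S_{m,k}$ denotes the Stirling number of the second kind (an empty sum is $0$).
   Context: A set partition of $[n]$ with exactly $k$ blocks is a collection $\{B_1,\dots,B_k\}$ of nonempty pairwise disjoint subsets with union $[n]$, indexed so that $\min B_1<\cdots<\min B_k$; $P_{n,k}$ is the set of such partitions. A partition is identified with its canonical sequential form $\pi=\pi_1\cdots\pi_n$, where $i\in B_{\pi_i}$. An entry $\pi_i$ is a record if $\pi_i>\pi_j$ for all $j<i$; the records are the first occurrences of $1,\dots,k$. For $a\in[k]$, $\mathrm{sumelements}_a(\pi)$ is the sum of all entries of $\pi$ at positions strictly before the record $a$, and $\mathrm{sumelements}(\pi)=\sum_{a=1}^{k}\mathrm{sumelements}_a(\pi)$. For example, $\mathrm{sumelements}(121132)=1+(1+2+1+1)=6$. *)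

(* Defs.v *)
From mathcomp Require Import all_boot.

Set Implicit Arguments.
Unset Strict Implicit.
Unset Printing Implicit Defensive.

(* The ground set [n] = {1, ..., n} is represented by 'I_n = {0, ..., n-1}. *)
Definition set_partitions (n k : nat) : {set {set {set 'I_n}}} :=
  [set P | partition P [set: 'I_n] && (#|P| == k)].

Definition stirling2 (n k : nat) : nat := #|set_partitions n k|.

(* The default value n is larger than every element of 'I_n, so this is the
   minimum of B as soon as B is nonempty. *)
Definition block_min (n : nat) (B : {set 'I_n}) : nat :=
  \big[minn/n]_(i in B) (i : nat).

(* B_1, ..., B_k, with min B_1 < ... < min B_k. *)
Definition ordered_blocks (n : nat) (P : {set {set 'I_n}}) : seq {set 'I_n} :=
  sort (fun A B => block_min A <= block_min B) (enum P).

(* The word pi_1 ... pi_n; blocks are numbered from 1. *)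
Definition canonical_form (n : nat) (P : {set {set 'I_n}}) : seq nat :=
  [seq (index (pblock P i) (ordered_blocks P)).+1 | i <- enum 'I_n].

(* Positions in words are counted from 0. *)
Definition is_record (w : seq nat) (p : nat) : bool :=
  all (fun x => x < nth 0 w p) (take p w).

(* The position of the record a, or size w if a is not a record of w. *)
Definition record_pos (w : seq nat) (a : nat) : nat :=
  find (fun p => is_record w p && (nth 0 w p == a)) (iota 0 (size w)).

Definition sumelements_at (a : nat) (w : seq nat) : nat :=
  \sum_(x <- take (record_pos w a) w) x.

Definition sumelements (n : nat) (P : {set {set 'I_n}}) : nat :=
  \sum_(1 <= a < #|P|.+1) sumelements_at a (canonical_form P).

(* Main.v *)
(** Canonical forms are the restricted growth words [w] with letter set
    [1..k], and in such a word the record [a] is the first occurrence of [a].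
    Deleting the last letter [x] of a restricted growth word leaves either a word
    on [1..k] with the same [sumelements], or, when [x = k] occurs only once, a
    word on [1..k-1], and then the sum of all remaining letters is lost. This
    gives linear recurrences for S(n, k), for the total U(n, k) of all letter
    sums, and T(n+1, k+1) = (k+1) T(n, k+1) + T(n, k) + U(n, k) for the total of
    [sumelements]. With H(n, k, i) = sum_j S(n-j, k) i^(j-1) and
    t_i = i (i+1) / 2 they are solved by
      U(n, k) = S(n, k) t_k + sum_(i <= k) t_i H(n, k, i),
      T(n, k) = S(n, k) sum_(a < k) t_a + sum_(i < k) (k - i) t_i H(n, k, i),
    using H(n+1, k+1, i) = (k+1) H(n, k+1, i) + H(n, k, i) and
    H(n, k, k+1) = S(n, k+1). *)
Require Import Defs.
From mathcomp Require Import all_boot all_order all_algebra.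
From mathcomp Require Import zify ring.
Import Order.TTheory GRing.Theory Num.Theory.

Set Implicit Arguments.
Unset Strict Implicit.
Unset Printing Implicit Defensive.

(** * Restricted growth words and their enumeration by the last letter *)

Definition is_rgf (k : nat) (w : seq nat) : Prop :=
  (forall a, (a \in w) = (0 < a <= k)) /\
  (forall i a, i < size w -> 0 < a < nth 0 w i -> a \in take i w).

Lemma is_rgf_rcons_old k w x : is_rgf k w -> 0 < x <= k -> is_rgf k (rcons w x).
Proof.
move=> [letters growth] xk; split=> [a|i a].
  by rewrite mem_rcons inE letters; case: eqP => // ->; rewrite xk.
rewrite size_rcons ltnS nth_rcons => le_i; rewrite -cats1 takel_cat //.
case: (ltnP i (size w)) => lt_i; first exact: growth.
have -> : i = size w by lia.
by rewrite eqxx take_size letters => ax; lia.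
Qed.

Lemma is_rgf_rcons_new k w : is_rgf k w -> is_rgf k.+1 (rcons w k.+1).
Proof.
move=> [letters growth]; split=> [a|i a].
  by rewrite mem_rcons inE letters; case: eqP; lia.
rewrite size_rcons ltnS nth_rcons => le_i; rewrite -cats1 takel_cat //.
case: (ltnP i (size w)) => lt_i; first exact: growth.
have -> : i = size w by lia.
by rewrite eqxx take_size letters.
Qed.

(** The two cases are whether the last letter already occurs in [w]. A letter that does not occur
    there must be the largest one. *)
Lemma is_rgf_rcons k w x : is_rgf k (rcons w x) ->
  (is_rgf k w /\ 0 < x <= k) \/
  (exists k', [/\ k = k'.+1, x = k & is_rgf k' w]).
Proof.
move=> [letters growth].
have xk : 0 < x <= k by rewrite -letters mem_rcons inE eqxx.
have growth' i a : i < size w -> 0 < a < nth 0 w i -> a \in take i w.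
  move=> lt_i a_lt; move: (growth i a).
  rewrite size_rcons nth_rcons lt_i -cats1 takel_cat; last exact: ltnW.
  by apply=> //; lia.
have [xw|xw] := boolP (x \in w).
  left; split=> //; split=> // a; rewrite -letters mem_rcons inE.
  by case: eqP => // ->.
right; have xk' : x = k.
  apply/eqP; apply: contraNT xw => x_neq.
  have kw : k \in w.
    have: k \in rcons w x by rewrite letters; lia.
    by rewrite mem_rcons inE; case/orP => // /eqP kx; lia.
  (* By growth, every smaller letter precedes the first [k] of [w], so [x < k] would already occur
     in [w]. *)
  apply: (mem_take (n0 := index k w)); apply: growth'; rewrite ?index_mem //.
  by rewrite nth_index //; lia.
exists k.-1; split=> //; first by lia.
split=> // a; have := letters a; rewrite mem_rcons inE.
by case: eqP => [->|] /=; rewrite ?(negbTE xw); lia.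
Qed.

Lemma is_rgf_nil k : is_rgf k [::] <-> k = 0.
Proof.
split=> [[letters _]|->]; last by split=> // a; rewrite in_nil; lia.
by have := letters k; rewrite in_nil; lia.
Qed.

(** The list follows the last-letter dichotomy, so that sums over it split exactly as in the
    Stirling recurrence. *)
Fixpoint rgf (n k : nat) : seq (seq nat) :=
  match n, k with
  | 0, 0 => [:: [::]]
  | 0, _.+1 => [::]
  | n'.+1, 0 => [::]
  | n'.+1, k'.+1 => [seq rcons w x | w <- rgf n' k, x <- iota 1 k]
                    ++ [seq rcons w k | w <- rgf n' k']
  end.

Lemma rgfS n k :
  rgf n.+1 k.+1 = [seq rcons w x | w <- rgf n k.+1, x <- iota 1 k.+1]
                  ++ [seq rcons w k.+1 | w <- rgf n k].
Proof. by []. Qed.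

Lemma mem_rgf n k w : w \in rgf n k <-> size w = n /\ is_rgf k w.
Proof.
elim: n k w => [|n IHn] k w.
  split; last first.
    by case=> /size0nil -> /is_rgf_nil ->; rewrite inE.
  case: k => [|k] //=; rewrite inE => /eqP ->.
  by split=> //; apply/is_rgf_nil.
split.
  case: k => [|k] //; rewrite rgfS mem_cat => /orP[/allpairsPdep|/mapP].
    case=> [v [x [/IHn[<- v_rgf]]]]; rewrite mem_iota => xk ->.
    by rewrite size_rcons; split=> //; apply: is_rgf_rcons_old.
  case=> v /IHn[<- v_rgf] ->; rewrite size_rcons; split=> //.
  exact: is_rgf_rcons_new.
case: (lastP w) => [|v x] [] //; rewrite size_rcons => -[size_v].
case/is_rgf_rcons => [[v_rgf xk]|[k' [-> -> v_rgf]]].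
  case: k v_rgf xk => [|k] v_rgf xk; first by lia.
  rewrite rgfS mem_cat; apply/orP; left; apply/allpairsPdep; exists v, x.
  by split=> //; [apply/IHn | rewrite mem_iota].
by rewrite rgfS mem_cat; apply/orP; right; apply/mapP; exists v => //; apply/IHn.
Qed.

(** The two halves are disjoint because, once the last letter is deleted, [k.+1] still occurs in
    words of the first half but not in those of the second. *)
Lemma rgf_uniq n k : uniq (rgf n k).
Proof.
elim: n k => [|n IHn] [|k] //; rewrite rgfS cat_uniq; apply/and3P; split.
- apply: (allpairs_uniq (f := rcons)) => //; first exact: iota_uniq.
  by move=> [v x] [v' x'] _ _ /rcons_inj [-> ->].
- apply/hasPn => w /mapP[v /mem_rgf[_ [v_letters _]] ->].
  apply/negP => /allpairsPdep[u [x [/mem_rgf[_ [u_letters _]] _]]].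
  case/rcons_inj => vu _; have := v_letters k.+1.
  by rewrite vu u_letters; lia.
- by rewrite map_inj_uniq // => u v /rcons_inj [].
Qed.

(* Each letter is determined by the kernel of the word: a letter that is not a
   repetition is the least positive integer not yet used. *)
Lemma is_rgf_kernel_inj k l v w : is_rgf k v -> is_rgf l w -> size v = size w ->
    (forall i j, i < size v -> j < size v ->
       (nth 0 v i == nth 0 v j) = (nth 0 w i == nth 0 w j)) ->
  v = w.
Proof.
move=> [v_letters v_growth] [w_letters w_growth] eq_size eq_ker.
apply: (eq_from_nth (x0 := 0) eq_size) => i.
elim/ltn_ind: i => i IHi lt_iv.
have lt_iw : i < size w by rewrite -eq_size.
have eq_take : take i v = take i w.
  apply: (eq_from_nth (x0 := 0)); first by rewrite !size_take eq_size.
  rewrite size_take lt_iv => j lt_ji; rewrite !nth_take //.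
  by apply: IHi => //; apply: ltn_trans lt_iv.
have repeated (u : seq nat) : i < size u -> (nth 0 u i \in take i u) ->
    exists2 j, j < i & nth 0 u j = nth 0 u i.
  move=> lt_iu /(nthP 0)[m]; rewrite size_take lt_iu => lt_mi.
  by rewrite nth_take //; exists m.
have v0 : 0 < nth 0 v i.
  by have := v_letters (nth 0 v i); rewrite mem_nth // => /esym/andP[].
have w0 : 0 < nth 0 w i.
  by have := w_letters (nth 0 w i); rewrite mem_nth // => /esym/andP[].
(* Equal kernels turn a repetition in either word into a repetition of the same earlier position in
   the other. *)
have old_eq j : j < i -> (nth 0 v j == nth 0 v i) || (nth 0 w j == nth 0 w i) ->
    nth 0 v i = nth 0 w i.
  move=> lt_ji; have lt_jv := ltn_trans lt_ji lt_iv.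
  have := eq_ker j i lt_jv lt_iv; have := IHi j lt_ji lt_jv.
  move=> eq_j eq_k; rewrite -eq_k orbb => vji; move: (vji).
  by rewrite eq_k -eq_j => /eqP <-; rewrite (eqP vji).
have [/(repeated _ lt_iv)[j lt_ji eq_j]|v_new] := boolP (nth 0 v i \in take i v).
  by apply: old_eq lt_ji _; rewrite eq_j eqxx.
have [/(repeated _ lt_iw)[j lt_ji eq_j]|w_new] := boolP (nth 0 w i \in take i w).
  by apply: old_eq lt_ji _; rewrite eq_j eqxx orbT.
(* Both letters are new. If they differed, growth of the word with the larger one would put the
   smaller one in the common prefix. *)
case: (ltngtP (nth 0 v i) (nth 0 w i)) => // lt_vw.
  by move: v_new; rewrite eq_take w_growth // v0.
by move: w_new; rewrite -eq_take v_growth // w0.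
Qed.

(** * Set partitions and their canonical forms: the bijection with restricted growth words *)

Lemma block_min_le n (B : {set 'I_n}) i : i \in B -> block_min B <= i.
Proof.
move=> iB; rewrite /block_min; have := mem_index_enum i.
elim: (index_enum _) => // j s IHs; rewrite inE big_cons => /predU1P[<-|i_s].
  by rewrite iB geq_minl.
by case: ifP => _; rewrite ?geq_min IHs ?orbT.
Qed.

Lemma block_min_attained n (B : {set 'I_n}) i :
  i \in B -> exists2 j, j \in B & block_min B = j.
Proof.
move=> iB; have [j jB j_min] := @arg_minnP _ i (mem B) (@nat_of_ord n) iB.
exists j => //; apply/eqP; rewrite eqn_leq; apply/andP; split.
  exact: block_min_le.
(* The base case is the default value [n], which exceeds every element of ['I_n]. *)
rewrite /block_min; elim/big_rec: _ => [|m x mB le_x]; first exact: ltnW.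
by rewrite leq_min le_x j_min.
Qed.

Section CanonicalForm.

Variables (n : nat) (P : {set {set 'I_n}}).
Hypothesis partP : partition P [set: 'I_n].

Lemma mem_ordered_blocks B : (B \in ordered_blocks P) = (B \in P).
Proof. by rewrite mem_sort mem_enum. Qed.

Lemma ordered_blocks_uniq : uniq (ordered_blocks P).
Proof. by rewrite sort_uniq enum_uniq. Qed.

Lemma size_ordered_blocks : size (ordered_blocks P) = #|P|.
Proof. by rewrite size_sort cardE. Qed.

Lemma pblock_ordered i : pblock P i \in ordered_blocks P.
Proof. by rewrite mem_ordered_blocks pblock_mem // (cover_partition partP) inE. Qed.

Lemma size_canonical_form : size (canonical_form P) = n.
Proof. by rewrite size_map size_enum_ord. Qed.

Lemma nth_canonical_form (i : 'I_n) :
  nth 0 (canonical_form P) i = (index (pblock P i) (ordered_blocks P)).+1.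
Proof. by rewrite (nth_map i) ?size_enum_ord // nth_ord_enum. Qed.

Lemma canonical_form_kernel (i j : 'I_n) :
  (nth 0 (canonical_form P) i == nth 0 (canonical_form P) j)
  = (pblock P i == pblock P j).
Proof.
rewrite !nth_canonical_form eqSS; apply/eqP/eqP => [|-> //].
by move/(index_inj set0); apply; apply: pblock_ordered.
Qed.

Lemma canonical_form_block (i : 'I_n) (B : {set 'I_n}) : i \in B -> B \in P ->
  nth 0 (canonical_form P) i = (index B (ordered_blocks P)).+1.
Proof.
by case/and3P: partP => _ tiP _ iB BP; rewrite nth_canonical_form (def_pblock tiP BP iB).
Qed.

(** The witness is the minimum of the [a]-th block. Letters start at 1 and list positions at 0,
    hence [a.-1]. *)
Lemma nth_ordered_blocks_attained a : 0 < a <= #|P| ->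
  exists2 j : 'I_n, nth 0 (canonical_form P) j = a &
    nat_of_ord j = block_min (nth set0 (ordered_blocks P) a.-1).
Proof.
move=> a_le; set B := nth _ _ _.
have lt_a : a.-1 < size (ordered_blocks P) by rewrite size_ordered_blocks; lia.
have BP : B \in P by rewrite -mem_ordered_blocks mem_nth.
have /set0Pn[i iB] : B != set0.
  by apply: contraTneq BP => ->; case/and3P: partP.
have [j jB j_min] := block_min_attained iB; exists j => //.
by rewrite (canonical_form_block jB BP) index_uniq ?ordered_blocks_uniq //; lia.
Qed.

(** Growth comes from sorting by minima: if the block numbered [a] comes before the block of [i],
    its minimum is at most the minimum of the latter, hence at most [i]. Equality is excluded since
    the letters differ. *)
Lemma canonical_form_rgf : is_rgf #|P| (canonical_form P).
Proof.
split=> [a|i a].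
  apply/idP/idP => [|a_le].
    case/(nthP 0) => i; rewrite size_canonical_form => lt_i.
    rewrite (nth_canonical_form (Ordinal lt_i)) => <-.
    by rewrite -size_ordered_blocks ltnS index_mem pblock_ordered.
  have [j <- _] := nth_ordered_blocks_attained a_le.
  by rewrite mem_nth // size_canonical_form.
rewrite {1}size_canonical_form => lt_i; pose oi := Ordinal lt_i.
rewrite (nth_canonical_form oi) => a_lt.
have lt_idx : index (pblock P oi) (ordered_blocks P) < size (ordered_blocks P).
  by rewrite index_mem pblock_ordered.
have a_le : 0 < a <= #|P| by rewrite -size_ordered_blocks; lia.
have [j w_j j_min] := nth_ordered_blocks_attained a_le.
have le_ji : j <= i.
  have oi_in : oi \in pblock P oi by rewrite mem_pblock (cover_partition partP) inE.
  apply: leq_trans (block_min_le oi_in); rewrite j_min.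
  have -> : pblock P oi = nth set0 (ordered_blocks P)
              (index (pblock P oi) (ordered_blocks P)).
    by rewrite nth_index // pblock_ordered.
  rewrite [X in _ <= block_min X]/=.
  apply: (sorted_leq_nth (leT := fun A B => block_min A <= block_min B)).
  - by move=> A B C; apply: leq_trans.
  - by move=> A; apply: leqnn.
  - by apply: sort_sorted => A B; apply: leq_total.
  - by rewrite inE; lia.
  - by rewrite inE.
  - by lia.
have lt_ji : j < i.
  rewrite ltn_neqAle le_ji andbT; apply/eqP => eq_ji.
  by have := nth_canonical_form oi; rewrite /= -eq_ji w_j; lia.
apply/(nthP 0); exists j; last by rewrite nth_take.
by rewrite size_take size_canonical_form lt_i.
Qed.

End CanonicalForm.

(** The block of a point is its kernel class, and every block, being nonempty, is the block of some
    point. *)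
Lemma partition_eq_pblock (T : finType) (P Q : {set {set T}}) :
    partition P [set: T] -> partition Q [set: T] ->
    (forall x y, (pblock P x == pblock P y) = (pblock Q x == pblock Q y)) ->
  P = Q.
Proof.
move=> partP partQ eq_ker.
have eq_block x : pblock P x = pblock Q x.
  apply/setP => y; case/and3P: (partP) => /eqP cP tiP _.
  case/and3P: (partQ) => /eqP cQ tiQ _.
  by rewrite -!eq_pblock ?cP ?cQ ?inE.
have sub (A B : {set {set T}}) : partition A [set: T] -> partition B [set: T] ->
    (forall x, pblock A x = pblock B x) -> A \subset B.
  move=> /and3P[_ tiA A0] partB eqAB; apply/subsetP => X XA.
  have /set0Pn[x xX] : X != set0 by apply: contraTneq XA => ->.
  by rewrite -(def_pblock tiA XA xX) eqAB pblock_mem // (cover_partition partB) inE.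
by apply/eqP; rewrite eqEsubset !sub.
Qed.

Lemma canonical_form_inj n :
  {in [pred P | partition P [set: 'I_n]] &, injective (@canonical_form n)}.
Proof.
move=> P Q; rewrite !inE => partP partQ eq_form.
apply: partition_eq_pblock => // i j.
by rewrite -!canonical_form_kernel // eq_form.
Qed.

(** The preimage is the partition of positions by equal letters. Its canonical form has the same
    kernel as [w], hence equals [w]. *)
Lemma canonical_form_surj n k w : size w = n -> is_rgf k w ->
  exists2 P : {set {set 'I_n}}, P \in set_partitions n k & canonical_form P = w.
Proof.
move=> size_w w_rgf; pose f (i : 'I_n) := nth 0 w i.
pose P := preim_partition f [set: 'I_n].
have partP : partition P [set: 'I_n] by apply: preim_partitionP.
have eq_ker (i j : 'I_n) : (pblock P i == pblock P j) = (f i == f j).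
  case/and3P: (partP) => /eqP cP tiP _; rewrite eq_pblock ?cP ?inE //.
  by rewrite pblock_equivalence_partition ?inE // => x y z _ _ _; split=> // /eqP ->.
have formP : canonical_form P = w.
  apply: is_rgf_kernel_inj (canonical_form_rgf partP) w_rgf _ _.
    by rewrite size_canonical_form.
  rewrite size_canonical_form => i j lt_i lt_j.
  by rewrite (canonical_form_kernel partP (Ordinal lt_i) (Ordinal lt_j)) eq_ker.
exists P => //; rewrite inE partP /=; apply/eqP.
have [letters _] := canonical_form_rgf partP; have [letters_w _] := w_rgf.
(* The two letter ranges of the same word agree; testing them at both upper bounds makes the bounds
   equal. *)
have eq_le a : (0 < a <= #|P|) = (0 < a <= k) by rewrite -letters formP letters_w.
by move: #|P| eq_le => m eq_le; have := eq_le k; have := eq_le m; lia.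
Qed.

Lemma canonical_form_perm n k :
  perm_eq [seq canonical_form P | P <- enum (set_partitions n k)] (rgf n k).
Proof.
apply: uniq_perm; last 1 first.
- move=> w; apply/mapP/idP => [[P]|/mem_rgf[size_w w_rgf]].
    rewrite mem_enum inE => /andP[partP /eqP <-] ->.
    by apply/mem_rgf; rewrite size_canonical_form; split=> //; apply: canonical_form_rgf.
  have [P P_in <-] := canonical_form_surj size_w w_rgf.
  by exists P; rewrite ?mem_enum.
- rewrite map_inj_in_uniq ?enum_uniq // => P Q; rewrite !mem_enum !inE.
  by move=> /andP[partP _] /andP[partQ _]; apply: canonical_form_inj.
- exact: rgf_uniq.
Qed.

Lemma stirling2_rgf n k : stirling2 n k = size (rgf n k).
Proof. by rewrite -(perm_size (canonical_form_perm n k)) size_map -cardE. Qed.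

(** * Records as first occurrences, and [sumelements] on words *)

Lemma record_pos_index k w a : is_rgf k w -> 0 < a <= k ->
  record_pos w a = index a w.
Proof.
move=> [letters growth] a_le.
have aw : a \in w by rewrite letters.
have lt_idx : index a w < size w by rewrite index_mem.
have recordE p : p < size w ->
    is_record w p && (nth 0 w p == a) = (p == index a w).
  move=> lt_p; apply/andP/eqP => [[/allP rec /eqP w_p]|->].
    (* A record exceeds all earlier letters, so its value is new. *)
    have notin : a \notin take p w.
      by apply/negP => /rec; rewrite w_p ltnn.
    rewrite -(cat_take_drop p w) index_cat (negbTE notin) size_take lt_p.
    by rewrite (drop_nth 0) // w_p /= eqxx addn0.
  rewrite nth_index //; split=> //; apply/allP => x /(nthP 0)[j].
  rewrite size_take lt_idx => lt_j; rewrite nth_take // nth_index // => x_eq.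
  have a_notin : a \notin take j w.
    apply/negP => /(nthP 0)[m]; rewrite size_take (ltn_trans lt_j lt_idx) => lt_m.
    by rewrite nth_take // => /eqP; have /= -> := before_find 0 (ltn_trans lt_m lt_j).
  rewrite -x_eq ltn_neqAle.
  have /= -> /= := before_find 0 lt_j.
  (* A larger letter at [j] would by growth have an [a] before it, contradicting that [index a w] is
     the first occurrence. *)
  rewrite leqNgt; apply/negP => lt_a.
  by move: a_notin; rewrite growth //; [exact: ltn_trans lt_idx | lia].
rewrite /record_pos.
rewrite (eq_in_find (a2 := pred1 (index a w))); last first.
  by move=> p; rewrite mem_iota add0n => /recordE.
have := @index_uniq _ 0 (index a w) (iota 0 (size w)).
by rewrite size_iota nth_iota // add0n; apply; rewrite ?iota_uniq.
Qed.

Definition word_sum (w : seq nat) : nat := \sum_(x <- w) x.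

Definition sum_before_records (k : nat) (w : seq nat) : nat :=
  \sum_(1 <= a < k.+1) word_sum (take (index a w) w).

Lemma sumelements_canonical n k (P : {set {set 'I_n}}) :
  P \in set_partitions n k ->
  sumelements P = sum_before_records k (canonical_form P).
Proof.
rewrite inE => /andP[partP /eqP <-].
apply: eq_big_nat => a a_le; rewrite /sumelements_at /word_sum.
by rewrite (record_pos_index (canonical_form_rgf partP)).
Qed.

Definition total_word_sum (n k : nat) : nat := \sum_(w <- rgf n k) word_sum w.

Definition total_sumelements (n k : nat) : nat :=
  \sum_(w <- rgf n k) sum_before_records k w.

Lemma sum_sumelements n k :
  \sum_(P in set_partitions n k) sumelements P = total_sumelements n k.
Proof.
rewrite (eq_bigr _ (@sumelements_canonical n k)) /total_sumelements.
by rewrite -(perm_big _ (canonical_form_perm n k)) /= big_map big_enum.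
Qed.

Lemma word_sum_rcons w x : word_sum (rcons w x) = word_sum w + x.
Proof. by rewrite /word_sum -cats1 big_cat big_seq1. Qed.

Lemma take_index_rcons (w : seq nat) a x :
  a \in w -> take (index a (rcons w x)) (rcons w x) = take (index a w) w.
Proof.
by move=> aw; rewrite -cats1 index_cat aw takel_cat // index_size.
Qed.

Lemma sum_before_records_rcons_old k w x : is_rgf k w ->
  sum_before_records k (rcons w x) = sum_before_records k w.
Proof.
move=> [letters _]; apply: eq_big_nat => a a_le.
by rewrite take_index_rcons // letters.
Qed.

(** The record [k.+1] stands at the end, so everything before it is the whole of [w]. *)
Lemma sum_before_records_rcons_new k w : is_rgf k w ->
  sum_before_records k.+1 (rcons w k.+1) = sum_before_records k w + word_sum w.
Proof.
move=> w_rgf; rewrite {1}/sum_before_records big_nat_recr //=.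
rewrite -/(sum_before_records k (rcons w k.+1)) sum_before_records_rcons_old //.
congr (_ + word_sum _); have [letters _] := w_rgf.
by rewrite -cats1 index_cat letters ltnn /= eqxx addn0 take_size_cat.
Qed.

(** * Recurrences from deleting the last letter *)

Lemma big_rgfS n k (F : seq nat -> nat) :
  \sum_(w <- rgf n.+1 k.+1) F w =
  \sum_(w <- rgf n k.+1) \sum_(1 <= x < k.+2) F (rcons w x)
  + \sum_(w <- rgf n k) F (rcons w k.+1).
Proof.
rewrite rgfS big_cat big_map; congr (_ + _).
rewrite big_allpairs_dep; apply: eq_bigr => w _.
by rewrite /index_iota subn1.
Qed.

Lemma stirling2S n k :
  stirling2 n.+1 k.+1 = k.+1 * stirling2 n k.+1 + stirling2 n k.
Proof.
rewrite !stirling2_rgf -!sum1_size big_rgfS; congr (_ + _).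
rewrite big_distrr /=; apply: eq_bigr => w _.
by rewrite sum_nat_const_nat subn1.
Qed.

Lemma stirling2_lt n k : n < k -> stirling2 n k = 0.
Proof.
elim: n k => [|n IHn] [|k] //; first by rewrite stirling2_rgf.
by rewrite ltnS stirling2S => lt_nk; rewrite !IHn //; lia.
Qed.

Lemma stirling2_0 n : stirling2 n.+1 0 = 0.
Proof. by rewrite stirling2_rgf. Qed.

Lemma total_word_sumS n k :
  total_word_sum n.+1 k.+1 =
    k.+1 * total_word_sum n k.+1
    + (\sum_(1 <= x < k.+2) x) * stirling2 n k.+1
    + (total_word_sum n k + k.+1 * stirling2 n k).
Proof.
rewrite /total_word_sum big_rgfS !stirling2_rgf -!sum1_size; congr (_ + _).
  rewrite !big_distrr -big_split /=; apply: eq_bigr => w _.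
  under eq_bigr => x _ do rewrite word_sum_rcons.
  by rewrite big_split /= sum_nat_const_nat subn1 muln1.
rewrite !big_distrr -big_split /=; apply: eq_bigr => w _.
by rewrite word_sum_rcons muln1.
Qed.

Lemma total_sumelementsS n k :
  total_sumelements n.+1 k.+1 =
    k.+1 * total_sumelements n k.+1
    + (total_sumelements n k + total_word_sum n k).
Proof.
rewrite /total_sumelements /total_word_sum big_rgfS; congr (_ + _).
  rewrite big_distrr !big_seq /=; apply: eq_bigr => w /mem_rgf[_ w_rgf].
  under eq_bigr => x _ do rewrite sum_before_records_rcons_old //.
  by rewrite sum_nat_const_nat subn1.
rewrite -big_split !big_seq /=; apply: eq_bigr => w /mem_rgf[_ w_rgf].
exact: sum_before_records_rcons_new.
Qed.

(** * Closed forms over the rationals *)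

Local Open Scope ring_scope.

Definition tri (i : nat) : rat := i%:R * (i%:R + 1) / 2%:R.

(* Coefficient of x^n in x / (1 - i x) * sum_m S(m, k) x^m. *)
Definition stirling_conv (n k i : nat) : rat :=
  \sum_(j < n) (stirling2 (n - j.+1) k)%:R * i%:R ^+ j.

Lemma stirling_conv_recl n k i :
  stirling_conv n.+1 k i = (stirling2 n k)%:R + i%:R * stirling_conv n k i.
Proof.
rewrite /stirling_conv big_ord_recl expr0 mulr1 subn1 /=; congr (_ + _).
rewrite big_distrr /=; apply: eq_bigr => j _.
by rewrite /bump /= add1n subSS exprS mulrCA.
Qed.

(** The last term of the longer sum contains S(0, k+1) = 0; the Stirling recurrence applies to each
    of the others. *)
Lemma stirling_convS n k i :
  stirling_conv n.+1 k.+1 i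
  = k.+1%:R * stirling_conv n k.+1 i + stirling_conv n k i.
Proof.
rewrite /stirling_conv big_ord_recr /= subnn stirling2_lt // mul0r addr0.
rewrite big_distrr -big_split /=; apply: eq_bigr => j _.
by rewrite subSS -(subnSK (ltn_ord j)) stirling2S natrD natrM mulrDl mulrA.
Qed.

(** At [i = k.+1] the two recurrences for [stirling_conv n.+1 k.+1 i] share the term with factor
    [k.+1], which cancels. *)
Lemma stirling_conv_diag n k : stirling_conv n k k.+1 = (stirling2 n k.+1)%:R.
Proof.
have := stirling_convS n k k.+1; rewrite stirling_conv_recl addrC.
by move/addrI/esym.
Qed.

Lemma tri0 : tri 0 = 0. Proof. by rewrite /tri !mul0r. Qed.

Lemma triS k : tri k.+1 = tri k + k.+1%:R.
Proof. by rewrite /tri -natr1; field. Qed.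

Lemma tri_sum k : (\sum_(1 <= x < k.+1) x)%N%:R = tri k.
Proof.
elim: k => [|k IHk]; first by rewrite big_geq // tri0.
by rewrite big_nat_recr //= natrD IHk triS.
Qed.

Lemma total_word_sumE n k : (total_word_sum n k)%:R =
  (stirling2 n k)%:R * tri k + \sum_(i < k.+1) tri i * stirling_conv n k i.
Proof.
elim: n k => [|n IHn] k.
  rewrite big1 => [|i _]; last by rewrite /stirling_conv big_ord0 mulr0.
  rewrite addr0 /total_word_sum stirling2_rgf; case: k => [|k] /=.
    by rewrite big_seq1 /word_sum big_nil tri0 mulr0.
  by rewrite big_nil mul0r.
case: k => [|k].
  by rewrite /total_word_sum stirling2_0 big_nil big_ord1 tri0 !mul0r addr0.
rewrite total_word_sumS !(natrD, natrM) tri_sum !IHn.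
under [X in _ = _ + X]eq_bigr => i _ do rewrite stirling_convS mulrDr mulrCA.
(* The top index [i = k.+1] is split off: by [stirling_conv_diag] it yields the term
   [tri k.+1 * stirling2 n k.+1] of the recurrence. *)
rewrite big_split /= -big_distrr /= [X in _ = _ + (_ + X)]big_ord_recr /=.
rewrite stirling_conv_diag stirling2S natrD natrM triS; ring.
Qed.

Lemma total_sumelementsE n k : (total_sumelements n k)%:R =
  (stirling2 n k)%:R * (\sum_(a < k) tri a)
  + \sum_(i < k) (k%:R - i%:R) * tri i * stirling_conv n k i.
Proof.
elim: n k => [|n IHn] k.
  rewrite [X in _ + X]big1 => [|i _]; last by rewrite /stirling_conv big_ord0 mulr0.
  rewrite addr0 /total_sumelements stirling2_rgf; case: k => [|k] /=.
    by rewrite big_seq1 /sum_before_records big_geq // big_ord0 mulr0.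
  by rewrite big_nil mul0r.
case: k => [|k].
  by rewrite /total_sumelements big_nil !big_ord0 mulr0 addr0.
rewrite total_sumelementsS !(natrD, natrM) total_word_sumE !IHn.
under [X in _ = _ + X]eq_bigr => i _ do rewrite stirling_convS mulrDr mulrCA.
rewrite big_split /= -big_distrr /= stirling2S natrD natrM.
(* Raising each weight by 1 adds one copy of the convolution sum in [total_word_sumE]; at [i = k]
   the old weight is 0. *)
have -> : \sum_(i < k.+1) (k.+1%:R - i%:R) * tri i * stirling_conv n k i =
    \sum_(i < k) (k%:R - i%:R) * tri i * stirling_conv n k i
    + \sum_(i < k.+1) tri i * stirling_conv n k i.
  rewrite !big_ord_recr /= addrA -big_split /=; congr (_ + _).
    by apply: eq_bigr => i _; rewrite -natr1; ring.
  by rewrite -natr1; ring.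
rewrite [\sum_(a < k.+1) tri a]big_ord_recr /=; ring.
Qed.

(** Beyond [n - k] the Stirling numbers have fewer points than blocks and vanish. *)
Lemma stirling_conv_trunc n k i : (k <= n)%N ->
  stirling_conv n k i
  = \sum_(1 <= j < (n - k).+1) (stirling2 (n - j) k)%:R * i%:R ^+ (j - 1).
Proof.
move=> le_kn; rewrite big_add1 /= big_mkord /stirling_conv.
rewrite (big_ord_widen n (fun j => (stirling2 (n - j.+1) k)%:R * i%:R ^+ (j.+1 - 1)))
  ?leq_subr // [RHS]big_mkcond /=.
apply: eq_bigr => j _; case: ifPn => [_|ge_j]; first by rewrite subn1.
by rewrite stirling2_lt ?mul0r //; have := ltn_ord j; lia.
Qed.

Theorem theorem2 (n k : nat) (hk : (1 <= k)%N) (hkn : (k <= n)%N) :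
  (\sum_(P in set_partitions n k) sumelements P)%N%:R =
    (stirling2 n k)%:R * (\sum_(1 <= a < k.+1) a%:R * (a%:R - 1) / 2%:R)
    + \sum_(1 <= i < k)
        ((k%:R - i%:R) * i%:R * (i%:R + 1) / 2%:R
         * \sum_(1 <= j < (n - k).+1)
             (stirling2 (n - j) k)%:R * i%:R ^+ (j - 1))
  :> rat.
Proof.
rewrite sum_sumelements total_sumelementsE; congr (_ * _ + _).
  rewrite big_add1 /= big_mkord; apply: eq_bigr => a _.
  by rewrite /tri -natr1; ring.
rewrite -(big_mkord xpredT (fun i => (k%:R - i%:R) * tri i * stirling_conv n k i)).
(* The index [i = 0], absent from the stated sum, contributes [tri 0 = 0]. *)
rewrite big_ltn // tri0 mulr0 mul0r add0r.
by apply: eq_bigr => i _; rewrite stirling_conv_trunc // /tri !mulrA.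
Qed.
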